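(* Let $x,y$ be real random variables with densities $p_x,p_y$ with respect to Lebesgue measure on $\mathbb{R}$. Assume the data follows the model $$y=f(x)+v(x)\,n,$$ where $n$ is a standardized Gaussian independent of $x$, and $f,v:\mathbb{R}\to\mathbb{R}$ are twice-differentiable with $v>0$. Suppose that a backward model exists, i.e. the data also follows the same kind of model in the other direction, $$x=g(y)+w(y)\,m,$$ where $m$ is a standardized Gaussian independent of $y$, and $g,w:\mathbb{R}\to\mathbb{R}$ are twice-differentiable with $w>0$. Then one of the following scenarios must hold: 1. $(v^2,f)=\left(\frac{1}{Q},\frac{P}{Q}\right)$ and $(w^2,g)=\left(\frac{1}{Q'},\frac{P'}{Q'}\right)$, where $Q,Q'$ are polynomials of degree two with $Q,Q'>0$ on $\mathbb{R}$, $P,P'$ are polynomials of degree two or less, and $p_x,p_y$ are strictly log-mix-rational-log. In particular, $\lim_{-\infty}v=\lim_{+\infty}v=0^+$, $\lim_{-\infty}f=\lim_{+\infty}f<\infty$, $\lim_{-\infty}w=\lim_{+\infty}w=0^+$, $\lim_{-\infty}g=\lim_{+\infty}g<\infty$, and $f,v,g,w$ are not invertible. 2. $v,w$ are constant, $f,g$ are linear, and $p_x,p_y$ are Gaussian densities.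
   Context: A density $p$ of a continuous real random variable is called strictly log-mix-rational-log if there are real parameters $\alpha>0$, $\gamma>0$, $\delta>0$ and $\beta,\alpha_0,\beta_0,\gamma_0,\delta_0\in\mathbb{R}$ with $\alpha_0^2<\alpha\delta$ and $\beta^2<4\alpha\gamma$ such that $$\log p(u) = -\tfrac12\delta u^2+\delta_0 u+\tfrac12\frac{(\alpha_0u^2+\beta_0u+\gamma_0)^2}{\alpha u^2+\beta u+\gamma}-\tfrac12\log(\alpha u^2+\beta u+\gamma)+\mathrm{const}.$$ The parameters may differ for $p_x$ and $p_y$. Here $Q',P'$ are just names of polynomials (not derivatives). ''Linear'' means of the form $u\mapsto au+b$ with $a,b\in\mathbb{R}$ ($a=0$ allowed). ''Standardized Gaussian'' means $N(0,1)$. Densities are understood up to equality almost everywhere. ''Not invertible'' means not injective on $\mathbb{R}$; ''$\lim<\infty$'' means the limits exist and are finite and equal. *)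

(* Defs.v *)
From HB Require Import structures.
From mathcomp Require Import all_boot all_order all_algebra.
From mathcomp Require Import all_classical all_reals all_analysis.

Set Implicit Arguments.
Unset Strict Implicit.
Unset Printing Implicit Defensive.

Import Order.TTheory GRing.Theory Num.Theory.
Import numFieldNormedType.Exports.

Local Open Scope classical_set_scope.
Local Open Scope ring_scope.

Definition twice_differentiable (R : realType) (f : R -> R) : Prop :=
  forall u : R, derivable f u 1 /\ derivable (derive1 f) u 1.

Definition has_density (d : measure_display) (T : measurableType d)
    (R : realType) (Pr : probability T R) (X : {RV Pr >-> R}) (p : R -> R)
    : Prop :=
  [/\ measurable_fun [set: R] p,
      (forall u, 0 <= p u) &
      forall A : set R, measurable A ->
        distribution Pr X A = (\int[lebesgue_measure]_(u in A) (p u)%:E)%E].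

Definition independent_RV (d : measure_display) (T : measurableType d)
    (R : realType) (Pr : probability T R) (X Y : {RV Pr >-> R}) : Prop :=
  forall A B : set R, measurable A -> measurable B ->
    Pr (X @^-1` A `&` Y @^-1` B) = (Pr (X @^-1` A) * Pr (Y @^-1` B))%E.

(* Since v > 0, the noise is almost surely determined by X and Y, namely
   (Y - f(X)) / v(X); asking for it on the sample space of X and Y is thus no
   restriction on the joint law of (X, Y). *)
Definition location_scale_model (d : measure_display) (T : measurableType d)
    (R : realType) (Pr : probability T R) (X Y : {RV Pr >-> R})
    (f v : R -> R) : Prop :=
  [/\ twice_differentiable f,
      twice_differentiable v,
      (forall u, 0 < v u) &
      exists N : {RV Pr >-> R},
        [/\ (forall A : set R, measurable A ->
               distribution Pr N A = normal_prob 0 1 A),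
            independent_RV X N &
            {ae Pr, forall t, Y t = f (X t) + v (X t) * N t}]].

(* Densities are considered up to equality almost everywhere.  Positivity is
   explicit because ln is 0 on nonpositive reals. *)
Definition strictly_log_mix_rational_log (R : realType) (p : R -> R) : Prop :=
  exists alpha beta gamma delta alpha0 beta0 gamma0 delta0 c : R,
    [/\ 0 < alpha, 0 < gamma & 0 < delta] /\
    alpha0 ^+ 2 < alpha * delta /\
    beta ^+ 2 < 4 * alpha * gamma /\
    {ae lebesgue_measure, forall u : R,
      0 < p u /\
      ln (p u) =
        - (1 / 2 * delta * u ^+ 2) + delta0 * u
        + 1 / 2 * ((alpha0 * u ^+ 2 + beta0 * u + gamma0) ^+ 2
                   / (alpha * u ^+ 2 + beta * u + gamma))
        - 1 / 2 * ln (alpha * u ^+ 2 + beta * u + gamma)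
        + c}.

Definition gaussian_density (R : realType) (p : R -> R) : Prop :=
  exists m s : R, 0 < s /\
    {ae lebesgue_measure, forall u : R, p u = normal_pdf m s u}.

(* Main.v *)
(** The joint law of (X, Y) has the density p_x(x) N(f(x), v(x)^2)(y) and also
    the density p_y(y) N(g(y), w(y)^2)(x), so the two agree almost everywhere,
    and p_x, p_y are positive almost everywhere. Taking logarithms,
      A(x) + P(x) y - Q(x) y^2 / 2 = A'(y) + P'(y) x - Q'(y) x^2 / 2
    with Q = 1/v^2, P = f/v^2, and similarly for Q', P'. Fixing three values of
    y shows that A, P, Q are quadratic functions of x, and likewise A', P', Q'
    are quadratic in y; both sides are then one polynomial sum c_ij x^i y^j with
    i, j <= 2. Positivity of Q and Q' leaves two cases. If c_22 <> 0, both Q and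
    Q' have degree two with negative discriminant, and solving the definition of
    A for log p_x gives the log-mix-rational-log form. If c_22 = 0, then Q and Q'
    are constant, c_21 = c_12 = 0, and log p_x is quadratic, with negative
    leading coefficient because p_x is integrable. *)

Require Import Defs.
From HB Require Import structures.
From mathcomp Require Import all_boot all_order all_algebra.
From mathcomp Require Import all_classical all_reals all_analysis.
From mathcomp Require Import measurable_realfun.
From mathcomp Require Import ring lra.

Set Implicit Arguments.
Unset Strict Implicit.
Unset Printing Implicit Defensive.

Import Order.TTheory GRing.Theory Num.Theory.
Import numFieldNormedType.Exports.

Local Open Scope classical_set_scope.
Local Open Scope ring_scope.

(** * Integration against a measure given by a density *)

Section density.
Local Open Scope ereal_scope.
Context d (T : measurableType d) (R : realType).
Variables (nu mu : {measure set T -> \bar R}) (p : T -> R).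
Hypothesis mp : measurable_fun [set: T] p.
Hypothesis p0 : forall x, (0 <= p x)%R.
Hypothesis nuE :
  forall A, measurable A -> nu A = \int[mu]_(x in A) (p x)%:E.

Import HBNNSimple.

(** By linearity over the finite image of [h], only indicators remain, and on these the claim is
    [nuE]. *)
Let integral_density_nnsfun (h : {nnsfun T >-> R}) :
  \int[nu]_x (h x)%:E = \int[mu]_x ((h x)%:E * (p x)%:E).
Proof.
have mp' : measurable_fun [set: T] (EFin \o p) by exact/measurable_EFinP.
have mh r : measurable (h @^-1` [set r]) by exact: measurable_sfunP.
under [LHS]eq_integral do rewrite fimfunE -fsumEFin//.
rewrite [LHS]ge0_integral_fsum//; last 2 first.
  - by move=> r; exact/measurable_EFinP/measurableT_comp.
  - by move=> n x _; rewrite EFinM nnfun_muleindic_ge0.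
under [RHS]eq_integral.
  move=> x xD; rewrite fimfunE -fsumEFin// ge0_mule_fsuml; last first.
    by move=> r; rewrite EFinM nnfun_muleindic_ge0.
  over.
rewrite [RHS]ge0_integral_fsum//; last 2 first.
  - move=> r; apply: emeasurable_funM => //.
    exact/measurable_EFinP/measurableT_comp.
  - move=> n x _; rewrite mule_ge0//; last by rewrite lee_fin.
    by rewrite EFinM nnfun_muleindic_ge0.
apply: eq_fsbigr => r _.
transitivity (\int[mu]_x (r%:E * ((\1_(h @^-1` [set r]) x)%:E * (p x)%:E)));
  last by apply: eq_integral => x _; rewrite muleA EFinM.
have [r0|r0] := ltP r 0%R.
  rewrite preimage_nnfun0//.
  by rewrite !integral0_eq// => x _; rewrite indic0 ?mulr0// mul0e mule0.
under [LHS]eq_integral do rewrite EFinM.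
rewrite !ge0_integralZl//.
- rewrite integral_indic// setIT nuE// integral_mkcond.
  congr (_ * _); apply: eq_integral => x _.
  by rewrite epatch_indic/= muleC.
- apply: emeasurable_funM => //; exact/measurable_EFinP/measurable_indic.
- by move=> x _; rewrite mule_ge0 ?lee_fin.
- exact/measurable_EFinP/measurable_indic.
Qed.

(** Simple functions increase to [F], and monotone convergence applies on both sides because [p] is
    nonnegative. *)
Lemma ge0_integral_density (F : T -> \bar R) : measurable_fun [set: T] F ->
  (forall x, 0 <= F x) -> \int[nu]_x F x = \int[mu]_x (F x * (p x)%:E).
Proof.
move=> mF F0; pose F_ := nnsfun_approx measurableT mF.
transitivity (limn (fun n => \int[nu]_x (F_ n x)%:E)).
  rewrite -monotone_convergence//=.
  - apply: eq_integral => x _; apply/esym/cvg_lim => //=.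
    exact: cvg_nnsfun_approx.
  - by move=> n; exact/measurable_EFinP.
  - by move=> n x _; rewrite lee_fin.
  - by move=> x _ a b ab; rewrite lee_fin//; exact/lefP/nd_nnsfun_approx.
transitivity (limn (fun n => \int[mu]_x ((F_ n x)%:E * (p x)%:E))).
  by congr (limn _); apply/funext => n; rewrite integral_density_nnsfun.
rewrite -monotone_convergence//=.
- apply: eq_integral => x _; apply/cvg_lim => //=.
  by apply: cvgeZr => //; exact: cvg_nnsfun_approx.
- by move=> n; apply: emeasurable_funM; exact/measurable_EFinP.
- by move=> n x _; rewrite mule_ge0// lee_fin.
- move=> x _ a b ab; rewrite lee_pmul// ?lee_fin//.
  exact/lefP/nd_nnsfun_approx.
Qed.

End density.

(** * Affine images of the standard Gaussian *)

Section affine_normal.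
Context {R : realType}.
Local Notation mu := (@lebesgue_measure R).

Definition affine_fun (m s : R) : measurableTypeR R -> measurableTypeR R :=
  fun n => m + s * n.

Lemma measurable_affine_fun m s : measurable_fun setT (affine_fun m s).
Proof. by apply: measurable_funD => //; exact: measurable_funM. Qed.

HB.instance Definition _ m s :=
  isMeasurableFun.Build _ _ _ _ (affine_fun m s) (measurable_affine_fun m s).

(** Lebesgue measure is determined by its values on half-open intervals. The affine preimage of such
    an interval has its length divided by [s], which the scaling compensates. *)
Lemma lebesgue_measure_affine (m : R) (s : {posnum R}) (A : set R) :
  measurable A ->
  mu A = pushforward (mscale s%:num%:nng mu) (affine_fun m s%:num) A.
Proof.
move=> mA.
have s0 : 0 < s%:num by [].
apply: lebesgue_measure_unique => //= _ [[a b]] _ <-.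
rewrite /mscale /pushforward.
have -> : affine_fun m s%:num @^-1` `]a, b]%classic =
    `](a - m) / s%:num, (b - m) / s%:num]%classic.
  apply/seteqP; split => x /=; rewrite !in_itv/= /affine_fun.
    by rewrite ltr_pdivrMr// ler_pdivlMr// => /andP[? ?]; apply/andP; split; lra.
  by rewrite ltr_pdivrMr// ler_pdivlMr// => /andP[? ?]; apply/andP; split; lra.
rewrite lebesgue_measure_itv/= [X in _ = (_ * X)%E]lebesgue_measure_itv/=.
rewrite !lte_fin ltr_pM2r ?invr_gt0// ltrD2r.
case: ifPn => _; last by rewrite mule0.
by rewrite -!EFinB -EFinM; congr EFin; field; rewrite gt_eqF.
Qed.

(** Change of variables [x = m + s * n]: the Jacobian [s] cancels the factor [1 / s] in the peak of
    the density. *)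
Lemma normal_prob_affine (m s : R) (A : set R) : 0 < s -> measurable A ->
  normal_prob 0 1 (affine_fun m s @^-1` A) = normal_prob m s A.
Proof.
move=> s0 mA; rewrite /normal_prob.
have s_neq0 : s != 0 by rewrite gt_eqF.
pose s' := PosNum s0.
transitivity (\int[pushforward (mscale (s'%:num%:nng)%R mu) (affine_fun m s'%:num)]_(x in A)
   (normal_pdf m s x)%:E)%E; last first.
  by apply: eq_measure_integral => //= B mB BA; rewrite -lebesgue_measure_affine.
have mf : measurable_fun A (fun x => (normal_pdf m s x)%:E).
  by apply/measurable_EFinP/measurable_funTS; exact: measurable_normal_pdf.
have maffine := @measurable_affine_fun m s.
have mA' : measurable (affine_fun m s @^-1` A).
  by rewrite -[X in measurable X]setTI; exact: maffine.
rewrite ge0_integral_pushforward//=; last first.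
  by move=> x _; rewrite lee_fin normal_pdf_ge0.
have mg : measurable_fun (affine_fun m s @^-1` A)
    (fun x => (normal_pdf m s (affine_fun m s x))%:E).
  apply/measurable_EFinP/measurable_funTS/measurableT_comp => //.
  exact: measurable_normal_pdf.
rewrite ge0_integral_mscale//=; last first.
  by move=> x _; rewrite lee_fin normal_pdf_ge0.
rewrite -ge0_integralZl//= ?lee_fin ?ltW//; last first.
  by move=> x _; rewrite lee_fin normal_pdf_ge0.
apply: eq_integral => x _; rewrite -EFinM; congr EFin.
rewrite !normal_pdfE ?oner_neq0// /normal_peak /normal_fun /affine_fun.
rewrite mulrA; congr (_ * expR _); last by field.
have -> : s ^+ 2 * pi *+ 2 = s ^+ 2 * (1 ^+ 2 * pi *+ 2).
  by rewrite expr1n mul1r mulrnAr.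
rewrite (sqrtrM (1 ^+ 2 * pi *+ 2)) ?sqr_ge0// sqrtr_sqr gtr0_norm//.
by rewrite invfM mulrA divff// mul1r.
Qed.

End affine_normal.

(** * The joint law of the pair in one direction of the model *)

Section joint_law.
Context d (T : measurableType d) (R : realType) (Pr : probability T R).
Local Notation mu := (@lebesgue_measure R).

Definition pair_RV (X Y : {RV Pr >-> R}) (t : T) : R * R := (X t, Y t).

Lemma measurable_pair_RV X Y : measurable_fun setT (pair_RV X Y).
Proof. exact: measurable_fun_pair. Qed.

HB.instance Definition _ X Y :=
  isMeasurableFun.Build _ _ _ _ (pair_RV X Y) (measurable_pair_RV X Y).

(** Independence is agreement on rectangles, which determines the product measure. *)
Lemma distribution_pair_RV (X Y : {RV Pr >-> R}) (E : set (R * R)) :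
  independent_RV X Y -> measurable E ->
  (distribution Pr X \x distribution Pr Y)%E E = distribution Pr (pair_RV X Y) E.
Proof.
by move=> XY mE; apply: product_measure_unique.
Qed.

Lemma ae_eq_measure_preimage d' (T' : measurableType d') (U V : T -> T')
    (E : set T') : measurable_fun setT U -> measurable_fun setT V ->
  measurable E -> {ae Pr, forall t, U t = V t} ->
  Pr (U @^-1` E) = Pr (V @^-1` E).
Proof.
move=> mU mV mE UV.
have mUE : measurable (U @^-1` E) by rewrite -[X in measurable X]setTI; exact: mU.
have mVE : measurable (V @^-1` E) by rewrite -[X in measurable X]setTI; exact: mV.
rewrite -[X in Pr X]setIT -integral_indic// -[X in _ = Pr X]setIT -integral_indic//.
apply: ae_eq_integral => //.
- by apply/measurable_EFinP; exact: measurable_indic.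
- by apply/measurable_EFinP; exact: measurable_indic.
- apply: filterS UV => t /= UVt _; rewrite !indicE.
  suff -> : (t \in U @^-1` E) = (t \in V @^-1` E) by [].
  by apply/idP/idP; rewrite !inE /= UVt.
Qed.

Lemma twice_differentiable_continuous (f : R -> R) :
  twice_differentiable f -> continuous f.
Proof.
by move=> fd x; apply: differentiable_continuous; apply/derivable1_diffP; case: (fd x).
Qed.

Lemma measurable_normal_pdf_pair (f v : R -> R) :
  continuous f -> continuous v -> (forall x, 0 < v x) ->
  measurable_fun [set: R * R] (fun z => normal_pdf (f z.1) (v z.1) z.2).
Proof.
move=> cf cv v0.
(* Since the scale never vanishes, the density is given by its closed formula everywhere, and
   measurability follows from continuity of [f] and [v]. *)
have -> : (fun z => normal_pdf (f z.1) (v z.1) z.2) = (fun z : R * R =>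
    normal_peak (v z.1) * expR (- (z.2 - f z.1) ^+ 2 * (v z.1 ^+ 2 *+ 2)^-1)).
  by apply/funext => z; rewrite normal_pdfE// gt_eqF.
have cv2 : continuous (fun x => v x ^+ 2).
  by move=> x; apply: (cvg_comp v (fun y => y ^+ 2)); [exact: cv|exact: exprn_continuous].
have m1 : measurable_fun [set: R] (fun x => normal_peak (v x)).
  apply: continuous_measurable_fun => x; rewrite /normal_peak.
  apply: cvgV.
    by rewrite gt_eqF// sqrtr_gt0 mulrn_wgt0// mulr_gt0 ?pi_gt0// exprn_gt0.
  apply: (cvg_comp (fun x => v x ^+ 2 * pi *+ 2) Num.sqrt); last exact: sqrt_continuous.
  by apply: cvgMn; apply: cvgMr_tmp; exact: cv2.
have m2 : measurable_fun [set: R] (fun x => (v x ^+ 2 *+ 2)^-1).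
  apply: continuous_measurable_fun => x; apply: cvgV.
    by rewrite gt_eqF// mulrn_wgt0// exprn_gt0.
  by apply: cvgMn; exact: cv2.
have mf := continuous_measurable_fun cf.
apply: measurable_funM; first by apply: (measurableT_comp m1); exact: measurable_fst.
apply: measurableT_comp => //; apply: measurable_funM; last first.
  by apply: (measurableT_comp m2); exact: measurable_fst.
apply: measurableT_comp => //; apply: measurable_funX.
apply: measurable_funB; first exact: measurable_snd.
by apply: (measurableT_comp mf); exact: measurable_fst.
Qed.

(** The law of [(X, N)] is a product, and [(X, Y)] is almost surely its image under
    [(x, n) |-> (x, f x + v x * n)]. For fixed [x] this map is affine in [n], so the inner integral
    is Gaussian. *)
Lemma joint_law (X Y : {RV Pr >-> R}) (p f v : R -> R) (E : set (R * R)) :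
  has_density X p -> location_scale_model X Y f v -> measurable E ->
  Pr [set t | E (X t, Y t)] =
  (\int[mu]_x \int[mu]_y
     ((\1_E (x, y))%:E * (p x * normal_pdf (f x) (v x) y)%:E))%E.
Proof.
move=> [mp p0 pE] [/twice_differentiable_continuous cf
  /twice_differentiable_continuous cv v0 [N [NN XN YE]]] mE.
pose Phi (z : R * R) := (z.1, f z.1 + v z.1 * z.2).
have mf := continuous_measurable_fun cf.
have mv := continuous_measurable_fun cv.
have mPhi : measurable_fun setT Phi.
  apply: measurable_fun_pair; first exact: measurable_fst.
  apply: measurable_funD; first by apply: (measurableT_comp mf); exact: measurable_fst.
  apply: measurable_funM; last exact: measurable_snd.
  by apply: (measurableT_comp mv); exact: measurable_fst.
have mPhiE : measurable (Phi @^-1` E) by rewrite -[X in measurable X]setTI; exact: mPhi.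
transitivity (distribution Pr (pair_RV X N) (Phi @^-1` E)).
  apply: (ae_eq_measure_preimage (U := pair_RV X Y) (V := Phi \o pair_RV X N)) => //.
  - exact: measurableT_comp.
  - by apply: filterS YE => t /= Yt; rewrite /pair_RV /Phi/= Yt.
rewrite -distribution_pair_RV// /product_measure1.
have mpdf := measurable_normal_pdf_pair cf cv v0.
have mpdfE : measurable_fun [set: R * R]
    (fun z => (\1_E z)%:E * (normal_pdf (f z.1) (v z.1) z.2)%:E)%E.
  by apply: emeasurable_funM; apply/measurable_EFinP => //; exact: measurable_indic.
have pdf0 z : (0 <= (\1_E z)%:E * (normal_pdf (f z.1) (v z.1) z.2)%:E)%E.
  by rewrite mule_ge0// lee_fin// normal_pdf_ge0.
transitivity (\int[distribution Pr X]_x \int[mu]_y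
   ((\1_E (x, y))%:E * (normal_pdf (f x) (v x) y)%:E))%E.
  apply: eq_integral => x _ /=.
  have mEx : measurable (xsection E x) by exact: measurable_xsection.
  have -> : xsection (Phi @^-1` E) x = affine_fun (f x) (v x) @^-1` xsection E x.
    by apply/seteqP; split => n; rewrite /xsection/= !inE.
  rewrite NN; last first.
    by rewrite -[X in measurable X]setTI; exact: measurable_affine_fun.
  rewrite normal_prob_affine// /normal_prob integral_mkcond.
  apply: eq_integral => y _; rewrite epatch_indic/= muleC.
  by rewrite !indicE mem_xsection.
have mF : measurable_fun [set: R] (fun x => \int[mu]_y
    ((\1_E (x, y))%:E * (normal_pdf (f x) (v x) y)%:E))%E.
  exact: (measurable_fun_fubini_tonelli_F (m2 := mu) _ mpdfE).
have F0 x : (0 <= \int[mu]_y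
    ((\1_E (x, y))%:E * (normal_pdf (f x) (v x) y)%:E))%E.
  by apply: integral_ge0 => y _; exact: (pdf0 (x, y)).
(* R and measurableTypeR R carry the same sigma-algebra with different displays. *)
have mX : measurable_fun setT X by [].
pose X' : {RV Pr >-> measurableTypeR R} :=
  HB.pack (X : T -> measurableTypeR R) (isMeasurableFun.Build _ _ _ (measurableTypeR R) _ mX).
rewrite ge0_integral_distribution//.
rewrite -[LHS](ge0_integral_distribution X')//.
(* The law of [X] is replaced by its density [p], which then moves inside the inner integral. *)
rewrite (ge0_integral_density (nu := distribution Pr X') (mu := mu) mp p0 pE)//.
apply: eq_integral => x _; rewrite muleC -ge0_integralZl ?lee_fin//.
- by apply: eq_integral => y _; rewrite muleCA EFinM.
- exact: (measurable_fun_pair2 x mpdfE).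
Qed.

End joint_law.

(** * Null sets and equality of densities on the plane *)

Section ae_product.
Context {R : realType}.
Local Notation mu := (@lebesgue_measure R).

(** The measure of a null set [N] is the integral of the measures of its sections, so almost all
    sections are null. *)
Lemma ae_product_sections (P : R * R -> Prop) :
  {ae (mu \x mu)%E, forall z, P z} ->
  {ae mu, forall x, {ae mu, forall y, P (x, y)}}.
Proof.
move=> [N [mN N0 PN]].
have : {ae mu, forall x, mu (xsection N x) = 0%E}.
  have mF : measurable_fun setT (mu \o xsection N).
    exact: measurable_fun_xsection.
  have /ae_eq_integral_abs : measurable_fun setT (mu \o xsection N) := mF.
  move=> /(_ mu measurableT)[+ _].
  under eq_integral do rewrite /= gee0_abs//.
  move=> /(_ N0); apply: filterS => x /= /(_ I).
  by [].
apply: filterS => x Nx; exists (xsection N x); split => //.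
  exact: measurable_xsection.
by move=> y /= nP; rewrite /xsection/= inE; exact: PN.
Qed.

(** By Tonelli both iterated integrals are integrals over [E] for the product measure. Finiteness
    makes [h] integrable, and an integrable function is determined almost everywhere by its
    integrals over measurable sets. *)
Lemma iterated_integral_ae_eq (h k : R * R -> R) :
  measurable_fun setT h -> measurable_fun setT k ->
  (forall z, 0 <= h z) -> (forall z, 0 <= k z) ->
  (\int[mu]_x \int[mu]_y (h (x, y))%:E < +oo)%E ->
  (forall E : set (R * R), measurable E ->
    \int[mu]_x \int[mu]_y ((\1_E (x, y))%:E * (h (x, y))%:E) =
    \int[mu]_y \int[mu]_x ((\1_E (x, y))%:E * (k (x, y))%:E))%E ->
  {ae (mu \x mu)%E, forall z, h z = k z}.
Proof.
move=> mh mk h0 k0 hfin hk.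
have mhE E : measurable E -> measurable_fun [set: measurableTypeR R * measurableTypeR R]
    (fun z => ((\1_E z)%:E * (h z)%:E)%E).
  move=> mE; apply: emeasurable_funM; apply/measurable_EFinP => //.
have mkE E : measurable E -> measurable_fun [set: measurableTypeR R * measurableTypeR R]
    (fun z => ((\1_E z)%:E * (k z)%:E)%E).
  move=> mE; apply: emeasurable_funM; apply/measurable_EFinP => //.
suff : ae_eq (mu \x mu)%E setT (EFin \o h) (EFin \o k).
  by apply: filterS => z /(_ I) [].
apply: integral_ae_eq => //.
- apply/integrableP; split; first exact/measurable_EFinP.
  under eq_integral do rewrite /= ger0_norm//.
  rewrite (fubini_tonelli1 (m1 := mu) (m2 := mu) (EFin \o h))//.
  exact/measurable_EFinP.
- exact/measurable_EFinP.
- move=> E _ mE.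
  transitivity (\int[(mu \x mu)%E]_z ((\1_E z)%:E * (h z)%:E))%E.
    rewrite integral_mkcond; apply: eq_integral => z _.
    by rewrite epatch_indic/= muleC.
  transitivity (\int[(mu \x mu)%E]_z ((\1_E z)%:E * (k z)%:E))%E; last first.
    rewrite [RHS]integral_mkcond; apply: eq_integral => z _.
    by rewrite epatch_indic/= muleC.
  rewrite (fubini_tonelli1 (m1 := mu) (m2 := mu))//=; last 2 first.
  - exact: mhE.
  - by move=> z; rewrite mule_ge0// lee_fin.
  rewrite (fubini_tonelli2 (m1 := mu) (m2 := mu))//=; last 2 first.
  - exact: mkE.
  - by move=> z; rewrite mule_ge0// lee_fin.
  exact: hk.
Qed.

End ae_product.

(** * Comparison of the forward and backward joint densities *)

Section two_way_model.
Context d (T : measurableType d) (R : realType) (Pr : probability T R).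
Local Notation mu := (@lebesgue_measure R).

Lemma joint_density_ae_eq (X Y : {RV Pr >-> R}) (p_x p_y f v g w : R -> R) :
  has_density X p_x -> has_density Y p_y ->
  location_scale_model X Y f v -> location_scale_model Y X g w ->
  {ae mu, forall x, {ae mu, forall y,
    p_x x * normal_pdf (f x) (v x) y = p_y y * normal_pdf (g y) (w y) x}}.
Proof.
move=> hX hY fw bw.
have [mpx px0 _] := hX; have [mpy py0 _] := hY.
have [/twice_differentiable_continuous cf /twice_differentiable_continuous cv v0 _] := fw.
have [/twice_differentiable_continuous cg /twice_differentiable_continuous cw w0 _] := bw.
pose h (z : R * R) := p_x z.1 * normal_pdf (f z.1) (v z.1) z.2.
pose k (z : R * R) := p_y z.2 * normal_pdf (g z.2) (w z.2) z.1.
apply: (ae_product_sections (P := fun z => h z = k z)).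
have mswap : measurable_fun [set: R * R] (fun z => (z.2, z.1)).
  by apply: measurable_fun_pair; [exact: measurable_snd|exact: measurable_fst].
apply: iterated_integral_ae_eq.
- apply: measurable_funM; first by apply: (measurableT_comp mpx); exact: measurable_fst.
  exact: measurable_normal_pdf_pair.
- apply: measurable_funM; first by apply: (measurableT_comp mpy); exact: measurable_snd.
  exact: (measurableT_comp (measurable_normal_pdf_pair cg cw w0) mswap).
- by move=> z; rewrite mulr_ge0// normal_pdf_ge0.
- by move=> z; rewrite mulr_ge0// normal_pdf_ge0.
- have := joint_law hX fw measurableT.
  under eq_integral do under eq_integral do rewrite indicT mul1e.
  by rewrite [X in Pr X](_ : _ = setT)// probability_setT => <-; rewrite ltry.
- move=> E mE; rewrite -(joint_law hX fw mE).
  (* The backward model describes the law of [(Y, X)], so it is applied to the reflection of [E]. *)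
  have mE' : measurable ((fun z : R * R => (z.2, z.1)) @^-1` E).
    by rewrite -[X in measurable X]setTI; exact: mswap.
  exact: (joint_law hY bw mE').
Qed.

(** Since [p] has mass one, some [x] with [p x > 0] satisfies the identity for almost every [y]; the
    left side is then positive, which forces [q y > 0]. *)
Lemma density_gt0_ae (p q : R -> R) (K L : R -> R -> R) :
  measurable_fun setT p ->
  (forall x, 0 <= p x) -> (forall y, 0 <= q y) ->
  (\int[mu]_x (p x)%:E = 1)%E ->
  (forall x y, 0 < K x y) -> (forall x y, 0 < L x y) ->
  {ae mu, forall x, {ae mu, forall y, p x * K x y = q y * L x y}} ->
  {ae mu, forall y, 0 < q y}.
Proof.
move=> mp p0 q0 p1 K0 L0 pq.
have [x [px pqx]] : exists x, 0 < p x /\ {ae mu, forall y, p x * K x y = q y * L x y}.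
  apply/not_existsP => np.
  have p_eq0 : ae_eq mu setT (EFin \o p) (cst 0%E).
    apply: (filterS (F := almost_everywhere mu)) pq => x pqx _ /=; have /not_andP[|//] := np x.
    by move=> /negP; rewrite -leNgt => px; congr EFin; apply/eqP; rewrite eq_le px p0.
  have : (\int[mu]_x (p x)%:E = 0)%E.
    rewrite (ae_eq_integral (cst 0%E) _ measurableT _ _ p_eq0) ?integral0//.
    exact/measurable_EFinP.
  by rewrite p1 => /eqP; rewrite eqe oner_eq0.
apply: (filterS (F := almost_everywhere mu)) pqx => y; have := mulr_gt0 px (K0 x y) => /[swap] ->.
by rewrite pmulr_lgt0.
Qed.

Lemma density_integral1 (X : {RV Pr >-> R}) p : has_density X p ->
  (\int[mu]_x (p x)%:E = 1)%E.
Proof. by move=> [_ _ /(_ setT measurableT) <-]; exact: probability_setT. Qed.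

(** This is the term free of [y] in the logarithm of the joint density, seen as a polynomial in
    [y]. *)
Definition log_constant_coef (p f v : R -> R) (x : R) :=
  ln (p x) + ln (normal_peak (v x)) - f x ^+ 2 / (v x ^+ 2 *+ 2).

Lemma ln_joint_density (p f v : R -> R) x y : 0 < p x -> 0 < v x ->
  ln (p x * normal_pdf (f x) (v x) y) =
  log_constant_coef p f v x + f x / v x ^+ 2 * y - (v x ^+ 2)^-1 / 2 * y ^+ 2.
Proof.
move=> px vx; have vN : v x != 0 by rewrite gt_eqF.
rewrite normal_pdfE// mulrA !lnM ?posrE ?mulr_gt0 ?normal_peak_gt0 ?expR_gt0//.
by rewrite expRK /log_constant_coef; field.
Qed.

(** Each marginal density is positive almost everywhere because the other one has mass one; only
    then may the logarithm of the products be split. *)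
Lemma log_density_ae_eq (X Y : {RV Pr >-> R}) (p_x p_y f v g w : R -> R) :
  has_density X p_x -> has_density Y p_y ->
  location_scale_model X Y f v -> location_scale_model Y X g w ->
  {ae mu, forall x, {ae mu, forall y,
    log_constant_coef p_x f v x + f x / v x ^+ 2 * y - (v x ^+ 2)^-1 / 2 * y ^+ 2 =
    log_constant_coef p_y g w y + g y / w y ^+ 2 * x - (w y ^+ 2)^-1 / 2 * x ^+ 2}}
  /\ {ae mu, forall x, 0 < p_x x}.
Proof.
move=> hX hY fw bw.
have [mpx px0 _] := hX; have [mpy py0 _] := hY.
have [_ _ v0 _] := fw; have [_ _ w0 _] := bw.
have pdf_gt0 (a b c : R) : 0 < b -> 0 < normal_pdf a b c.
  move=> b0; rewrite normal_pdfE ?gt_eqF// mulr_gt0 ?expR_gt0//.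
  by rewrite normal_peak_gt0// gt_eqF.
have xy := joint_density_ae_eq hX hY fw bw.
have yx := joint_density_ae_eq hY hX bw fw.
have px_gt0 : {ae mu, forall x, 0 < p_x x}.
  apply: (density_gt0_ae (K := fun y x => normal_pdf (g y) (w y) x)
    (L := fun y x => normal_pdf (f x) (v x) y) mpy) => //.
  - exact: density_integral1 hY.
  - by move=> *; exact: pdf_gt0.
  - by move=> *; exact: pdf_gt0.
have py_gt0 : {ae mu, forall y, 0 < p_y y}.
  apply: (density_gt0_ae (K := fun x y => normal_pdf (f x) (v x) y)
    (L := fun x y => normal_pdf (g y) (w y) x) mpx) => //.
  - exact: density_integral1 hX.
  - by move=> *; exact: pdf_gt0.
  - by move=> *; exact: pdf_gt0.
split=> //; apply: (filterS2 (F := almost_everywhere mu)) px_gt0 xy => x px; apply: (filterS2 (F := almost_everywhere mu)) py_gt0 => y py.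
by rewrite -!ln_joint_density// => ->.
Qed.

End two_way_model.

(** * Functions that are quadratic almost everywhere *)

Section ae_quadratic.
Context {R : realType}.
Local Notation mu := (@lebesgue_measure R).
Implicit Types (A P Q : R -> R).

(** An interval of positive length cannot lie in a null set. *)
Lemma ae_exists_itv (S : R -> Prop) (a b : R) : a < b -> {ae mu, forall x, S x} ->
  exists2 x, a < x < b & S x.
Proof.
move=> ab [N [mN N0 SN]]; apply/not_exists2P => nS.
have : `]a, b[%classic `<=` N.
  by move=> x /= xab; apply: SN => /= Sx; have [|] := nS x; [rewrite in_itv/= in xab|].
move=> /(le_measure mu); rewrite !inE => /(_ (measurable_itv _) mN).
rewrite [leRHS]N0 [leLHS]lebesgue_measure_itv/= lte_fin ab -EFinB lee_fin.
by rewrite leNgt subr_gt0 ab.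
Qed.

(** A point where [f] and [g] differ has a whole neighbourhood of such points, and this has positive
    measure. *)
Lemma ae_eq_continuous (f g : R -> R) : continuous f -> continuous g ->
  {ae mu, forall x, f x = g x} -> forall x, f x = g x.
Proof.
move=> cf cg fg x; apply/eqP; rewrite -subr_eq0; apply/negP => /negP fgx.
have : \forall y \near x, f y - g y != 0.
  have cfg : {for x, continuous (fun y => f y - g y)}.
    by apply: cvgB; [exact: cf|exact: cg].
  exact: (cvgr_neq0 _ cfg).
move=> /nbhs_ballP[e /= e0 xe].
have [y /andP[xy yx] fgy] := @ae_exists_itv _ (x - e) (x + e) ltac:(lra) fg.
have : f y - g y != 0.
  by apply: xe; rewrite /ball/= ltr_norml; apply/andP; split; lra.
by rewrite fgy subrr eqxx.
Qed.

Definition quad (a b c x : R) := a + b * x + c * x ^+ 2.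

Lemma continuous_quad a b c : continuous (quad a b c).
Proof.
move=> x; apply: cvgD; last by apply: cvgMl_tmp; exact: exprn_continuous.
by apply: cvgD; [exact: cvg_cst|apply: cvgMl_tmp; exact: cvg_id].
Qed.

(** These are the coefficients of the Lagrange interpolant at three nodes; [l1], [l2], [l3] are the
    inverses of its denominators. *)
Lemma quad_interpolation (y1 y2 y3 a b c : R) : y1 < y2 -> y2 < y3 ->
  let l1 := ((y1 - y2) * (y1 - y3))^-1 in
  let l2 := ((y2 - y1) * (y2 - y3))^-1 in
  let l3 := ((y3 - y1) * (y3 - y2))^-1 in
  [/\ a = y2 * y3 * l1 * quad a b c y1 + y1 * y3 * l2 * quad a b c y2
          + y1 * y2 * l3 * quad a b c y3,
      b = - (y2 + y3) * l1 * quad a b c y1 - (y1 + y3) * l2 * quad a b c y2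
          - (y1 + y2) * l3 * quad a b c y3
    & c = l1 * quad a b c y1 + l2 * quad a b c y2 + l3 * quad a b c y3].
Proof.
move=> y12 y23 /=.
have n12 : y1 - y2 != 0 by rewrite lt_eqF//; lra.
have n13 : y1 - y3 != 0 by rewrite lt_eqF//; lra.
have n23 : y2 - y3 != 0 by rewrite lt_eqF//; lra.
have n21 : y2 - y1 != 0 by rewrite gt_eqF//; lra.
have n31 : y3 - y1 != 0 by rewrite gt_eqF//; lra.
have n32 : y3 - y2 != 0 by rewrite gt_eqF//; lra.
by rewrite /quad; split; field; rewrite ?n12 ?n13 ?n23 ?n21 ?n31 ?n32.
Qed.

(* Three values of y determine A x, P x and Q x by Lagrange interpolation,
   as quadratic functions of x; no derivatives are involved. *)
Lemma ae_quad_coef A P Q A' P' Q' :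
  {ae mu, forall y, {ae mu, forall x,
    quad (A x) (P x) (Q x) y = quad (A' y) (P' y) (Q' y) x}} ->
  exists a0 a1 a2 p0 p1 p2 q0 q1 q2 : R,
  {ae mu, forall x, [/\ A x = quad a0 a1 a2 x,
    P x = quad p0 p1 p2 x & Q x = quad q0 q1 q2 x]}.
Proof.
move=> H.
(* Disjoint intervals make the three nodes distinct and ordered. *)
have [y1 /andP[y1l y1u] H1] := ae_exists_itv (ltr01 : (0 : R) < 1) H.
have [y2 /andP[y2l y2u] H2] := @ae_exists_itv _ 2 3 ltac:(lra) H.
have [y3 /andP[y3l y3u] H3] := @ae_exists_itv _ 4 5 ltac:(lra) H.
have y12 : y1 < y2 by lra.
have y23 : y2 < y3 by lra.
set l1 := ((y1 - y2) * (y1 - y3))^-1.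
set l2 := ((y2 - y1) * (y2 - y3))^-1.
set l3 := ((y3 - y1) * (y3 - y2))^-1.
pose c (F : R -> R) (m1 m2 m3 : R) := m1 * F y1 + m2 * F y2 + m3 * F y3.
pose ca F := c F (y2 * y3 * l1) (y1 * y3 * l2) (y1 * y2 * l3).
pose cp F := c F (- (y2 + y3) * l1) (- (y1 + y3) * l2) (- (y1 + y2) * l3).
pose cq F := c F l1 l2 l3.
exists (ca A'), (ca P'), (ca Q'), (cp A'), (cp P'), (cp Q'), (cq A'), (cq P'), (cq Q').
apply: (filterS3 (F := almost_everywhere mu)) H1 H2 H3 => x H1 H2 H3.
have [] := quad_interpolation (A x) (P x) (Q x) y12 y23.
rewrite -/l1 -/l2 -/l3 H1 H2 H3 => -> -> ->.
by rewrite /ca /cp /cq /c /quad; split; ring.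
Qed.

(** Both sides are polynomials of degree at most two in each variable. Almost everywhere equality
    extends to the plane by continuity, one variable at a time, and the coefficients then agree up
    to transposition. *)
Lemma quad_eq A P Q A' P' Q' (a0 a1 a2 p0 p1 p2 q0 q1 q2
    a0' a1' a2' p0' p1' p2' q0' q1' q2' : R) :
  {ae mu, forall x, A x = quad a0 a1 a2 x} -> (forall x, P x = quad p0 p1 p2 x) ->
  (forall x, Q x = quad q0 q1 q2 x) ->
  {ae mu, forall x, A' x = quad a0' a1' a2' x} ->
  (forall x, P' x = quad p0' p1' p2' x) -> (forall x, Q' x = quad q0' q1' q2' x) ->
  {ae mu, forall x, {ae mu, forall y,
    quad (A x) (P x) (Q x) y = quad (A' y) (P' y) (Q' y) x}} ->
  [/\ a0' = a0, a1' = p0 & a2' = q0] /\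
  [/\ p0' = a1, p1' = p1 & p2' = q1] /\ [/\ q0' = a2, q1' = p2 & q2' = q2].
Proof.
move=> HA HP HQ HA' HP' HQ' H.
pose F x y := quad (quad a0 a1 a2 x) (quad p0 p1 p2 x) (quad q0 q1 q2 x) y.
pose F' x y := quad (quad a0' p0' q0' x) (quad a1' p1' q1' x) (quad a2' p2' q2' x) y.
have F'E x y : F' x y =
    quad (quad a0' a1' a2' y) (quad p0' p1' p2' y) (quad q0' q1' q2' y) x.
  by rewrite /F' /quad; ring.
have FE x y : F x y = quad (quad a0 p0 q0 y) (quad a1 p1 q1 y) (quad a2 p2 q2 y) x.
  by rewrite /F /quad; ring.
have H1 : {ae mu, forall x, forall y, F x y = F' x y}.
  apply: (filterS2 (F := almost_everywhere mu)) HA H => x HAx Hx.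
  apply: ae_eq_continuous; [exact: continuous_quad|exact: continuous_quad|].
  apply: (filterS2 (F := almost_everywhere mu)) HA' Hx => y HAy.
  by rewrite HAx HP HQ HAy HP' HQ' F'E.
have FF' x y : F x y = F' x y.
  rewrite FE F'E; move: x; apply: ae_eq_continuous; [exact: continuous_quad|exact: continuous_quad|].
  by apply: (filterS (F := almost_everywhere mu)) H1 => x /(_ y); rewrite FE F'E.
(* The nine values on the grid of points with coordinates [0], [1], [-1] determine the nine
   coefficients linearly. *)
have e00 := FF' 0 0; have e01 := FF' 0 1; have e02 := FF' 0 (-1).
have e10 := FF' 1 0; have e11 := FF' 1 1; have e12 := FF' 1 (-1).
have e20 := FF' (-1) 0; have e21 := FF' (-1) 1; have e22 := FF' (-1) (-1).
clear -e00 e01 e02 e10 e11 e12 e20 e21 e22.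
rewrite /F /F' /quad ?expr0n ?expr1n ?sqrrN ?expr1n ?mulr0 ?mulr1 ?addr0 ?mulrN1 in e00 e01 e02 e10 e11 e12 e20 e21 e22.
by repeat split; lra.
Qed.

End ae_quadratic.

(** * Positive quadratics and ratios of quadratics *)

Section quad_theory.
Context {R : realType}.
Implicit Types a b c : R.

(** One evaluation settles each case: a real root if [c < 0], the vertex if [c > 0], and [- a / b]
    if [c = 0] and [b] is nonzero. *)
Lemma quad_gt0 a b c : (forall x, 0 < quad a b c x) ->
  0 < a /\ (c = 0 /\ b = 0 \/ 0 < c /\ b ^+ 2 < 4 * c * a).
Proof.
move=> abc0; have a0 : 0 < a.
  by have := abc0 0; rewrite /quad mulr0 expr0n/= mulr0 !addr0.
split => //; case: (ltgtP c 0) => [c0|c0|c0].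
- pose D := b ^+ 2 - 4 * a * c.
  have D0 : 0 <= D by rewrite /D; have := sqr_ge0 b; nra.
  have cN : c != 0 by rewrite lt_eqF.
  have := abc0 ((- b + Num.sqrt D) / (2 * c)).
  have -> : quad a b c ((- b + Num.sqrt D) / (2 * c)) = (Num.sqrt D ^+ 2 - D) / (4 * c).
    by rewrite /quad /D; field.
  by rewrite sqr_sqrtr// subrr mul0r ltxx.
- right; split => //; have cN : c != 0 by rewrite gt_eqF.
  have := abc0 (- b / (2 * c)).
  have -> : quad a b c (- b / (2 * c)) = (4 * c * a - b ^+ 2) / (4 * c).
    by rewrite /quad; field.
  by rewrite pmulr_lgt0 ?subr_gt0// invr_gt0 mulr_gt0.
- left; split => //; apply/eqP/negPn/negP => bN.
  have := abc0 (- a / b).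
  have -> : quad a b c (- a / b) = 0 by rewrite /quad c0; field.
  by rewrite ltxx.
Qed.

(* Up to the factor s - t, the cross difference of two quadratics is a
   symmetric bilinear form m s t + n (s + t) + k; solving for t yields a
   collision as long as s is not a fixed point of the resulting involution. *)
Lemma quad_ratio_not_injective p0 p1 p2 q0 q1 q2 : q2 != 0 ->
  exists2 st : R * R, st.1 != st.2 &
  quad p0 p1 p2 st.1 * quad q0 q1 q2 st.2 = quad p0 p1 p2 st.2 * quad q0 q1 q2 st.1.
Proof.
move=> q2N.
pose m := p2 * q1 - p1 * q2; pose n := p2 * q0 - p0 * q2; pose k := p1 * q0 - p0 * q1.
have key s t : m * s * t + n * (s + t) + k = 0 ->
    quad p0 p1 p2 s * quad q0 q1 q2 t = quad p0 p1 p2 t * quad q0 q1 q2 s.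
  move=> st0; apply/eqP; rewrite -subr_eq0; apply/eqP.
  transitivity ((s - t) * (m * s * t + n * (s + t) + k)); last by rewrite st0 mulr0.
  by rewrite /quad /m /n /k; ring.
have [m0|mN] := eqVneq m 0.
  have [n0|nN] := eqVneq n 0.
    (* Here [k] vanishes too, so the ratio is constant and any two points collide. *)
    exists (0, 1) => /=; first by rewrite eq_sym oner_eq0.
    apply: key; rewrite m0 n0 !mul0r !add0r.
    have : k * q2 = 0.
      transitivity (- q0 * m + q1 * n); first by rewrite /m /n /k; ring.
      by rewrite m0 n0 !mulr0 addr0.
    by move/eqP; rewrite mulf_eq0 (negbTE q2N) orbF => /eqP.
  (* For [m = 0] the equation fixes the sum [s + t = - k / n]. *)
  exists (- k / (2 * n) + 1, - k / (2 * n) - 1) => /=.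
    by apply/negP => /eqP; lra.
  by apply: key; rewrite m0; field.
(* The point [s = - n / m + e] avoids the pole of the involution if [e] is nonzero, and is fixed
   exactly when [m * e ^+ 2 + (k - n ^+ 2 / m) = 0]. Since [m] is nonzero, [1] and [2] cannot both
   solve this. *)
have [e e0 eN] : exists2 e : R, e != 0 & m * e ^+ 2 + (k - n ^+ 2 / m) != 0.
  have [e1|] := eqVneq (m * 1 ^+ 2 + (k - n ^+ 2 / m)) 0; last first.
    by exists 1 => //; exact: oner_neq0.
  exists 2 => //; rewrite expr1n mulr1 in e1; apply/negP => /eqP e2.
  by move/eqP: mN; apply; lra.
pose s := - n / m + e.
exists (s, - (n * s + k) / (m * e)) => /=.
  apply: contra_neq eN => st.
  have : m * e * s = - (n * s + k).
    by rewrite [in LHS]st mulrC divfK// mulf_neq0.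
  rewrite /s => h.
  suff : m * e ^+ 2 + (k - n ^+ 2 / m) = m * e * (- n / m + e) + (n * (- n / m + e) + k).
    by move=> ->; rewrite h addNr.
  by field.
by apply: key; rewrite /s; field; rewrite mN e0.
Qed.

(** Dividing by [u ^+ 2] turns both quadratics into their reversals in [u^-1], which are continuous
    at [0]. A general filter covers both infinities. *)
Lemma quad_ratio_cvg (F : set_system R) {FF : ProperFilter F} p0 p1 p2 q0 q1 q2 :
  u^-1 @[u --> F] --> 0 -> (\forall u \near F, u != 0) -> q2 != 0 ->
  quad p0 p1 p2 u / quad q0 q1 q2 u @[u --> F] --> p2 / q2.
Proof.
move=> F0 FN q2N.
have quadV (a b c : R) : quad c b a u^-1 @[u --> F] --> c.
  have := @cvg_comp _ _ _ (fun u : R => u^-1) (quad c b a) F (nbhs 0) _ F0.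
  move=> /(_ _ (@continuous_quad _ c b a 0)).
  by rewrite /quad mulr0 expr0n/= mulr0 !addr0.
apply: (@cvg_trans _ ((fun u : R => quad p2 p1 p0 u^-1 / quad q2 q1 q0 u^-1) @ F)); last first.
  by apply: cvgM; [exact: quadV|apply: cvgV => //; exact: quadV].
apply: near_eq_cvg; near=> u.
have uN : u != 0 by near: u.
have quadE (a b c : R) : quad a b c u = u ^+ 2 * quad c b a u^-1.
  by rewrite /quad; field.
by rewrite !quadE invfM mulrACA divff ?mul1r// expf_neq0.
Unshelve. all: by end_near. Qed.

Lemma quad_ratio_cvgy (p0 p1 p2 q0 q1 q2 : R) : q2 != 0 ->
  quad p0 p1 p2 u / quad q0 q1 q2 u @[u --> +oo] --> p2 / q2.
Proof.
move=> q2N; apply: quad_ratio_cvg => //.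
  by apply/(gtr0_cvgV0 (f := id)) => //; exact: nbhs_pinfty_gt.
by near=> u; rewrite gt_eqF//; near: u; exact: nbhs_pinfty_gt.
Unshelve. all: by end_near. Qed.

Lemma quad_ratio_cvgNy (p0 p1 p2 q0 q1 q2 : R) : q2 != 0 ->
  quad p0 p1 p2 u / quad q0 q1 q2 u @[u --> -oo] --> p2 / q2.
Proof.
move=> q2N; apply: quad_ratio_cvg => //.
  by apply/(ltr0_cvgV0 (f := id)) => //; exact: nbhs_ninfty_lt.
by near=> u; rewrite lt_eqF//; near: u; exact: nbhs_ninfty_lt.
Unshelve. all: by end_near. Qed.

End quad_theory.

(** * The two scenarios, for one direction of the model *)

Section scenarios.
Context {R : realType}.
Local Notation mu := (@lebesgue_measure R).

(** On the half-line where [b * x] is nonnegative the integrand is at least [expR a], and this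
    half-line has infinite measure. *)
Lemma exp_quad_integral_pinfty (a b c : R) : 0 <= c ->
  (\int[mu]_x (expR (quad a b c x))%:E = +oo)%E.
Proof.
move=> c0.
have mq : measurable_fun [set: R] (quad a b c).
  by apply: continuous_measurable_fun; exact: continuous_quad.
have me : measurable_fun [set: R] (fun x => (expR (quad a b c x))%:E).
  by apply/measurable_EFinP; exact: (measurableT_comp _ mq).
have [D [mD Doo Dq]] : exists D : set R, [/\ measurable D, mu D = +oo%E &
    forall x, D x -> a <= quad a b c x].
  have [b0|b0] := leP 0 b.
    exists `[0, +oo[%classic; split; [exact: measurable_itv| |].
      by rewrite lebesgue_measure_itv/= ltry oppr0 addye.
    move=> x /=; rewrite in_itv/= andbT => x0.
    by rewrite /quad -addrA lerDl addr_ge0// mulr_ge0// sqr_ge0.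
  exists `]-oo, 0]%classic; split; [exact: measurable_itv| |].
    by rewrite lebesgue_measure_itv/= ltNyr add0e.
  move=> x /=; rewrite in_itv/= => x0.
  rewrite /quad -addrA lerDl addr_ge0//; first by rewrite mulr_le0// ltW.
  by rewrite mulr_ge0// sqr_ge0.
apply/eqP; rewrite -leye_eq.
apply: (@le_trans _ _ (\int[mu]_(x in D) (expR a)%:E)%E).
  by rewrite integral_cst// [X in (_ * X)%E]Doo gt0_muley// lte_fin expR_gt0.
apply: (@le_trans _ _ (\int[mu]_(x in D) (expR (quad a b c x))%:E)%E).
  apply: ge0_le_integral => //.
  - exact: measurable_funTS.
  - by move=> x Dx; rewrite lee_fin ler_expR Dq.
exact: ge0_subset_integral.
Qed.

Lemma exp_quad_gaussian (p : R -> R) (a b c : R) : measurable_fun setT p ->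
  (\int[mu]_x (p x)%:E = 1)%E -> {ae mu, forall x, p x = expR (quad a b c x)} ->
  gaussian_density p.
Proof.
move=> mp p1 pE.
have mq : measurable_fun [set: R] (quad a b c).
  by apply: continuous_measurable_fun; exact: continuous_quad.
have q1 : (\int[mu]_x (expR (quad a b c x))%:E = 1)%E.
  rewrite -p1; apply: ae_eq_integral => //.
  - by apply/measurable_EFinP; exact: (measurableT_comp _ mq).
  - exact/measurable_EFinP.
  - by apply: (filterS (F := almost_everywhere mu)) pE => x -> _.
have c0 : c < 0.
  by rewrite ltNge; apply/negP => /(exp_quad_integral_pinfty a b); rewrite q1.
have cN : c != 0 by rewrite lt_eqF.
(* Completing the square gives the mean [m] and [c = - 1 / (2 * s ^+ 2)]. *)
pose s := Num.sqrt (- (2 * c)^-1); pose m := - b / (2 * c).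
have s2_gt0 : 0 < - (2 * c)^-1 by rewrite oppr_gt0 invr_lt0; lra.
have s2 : s ^+ 2 = - (2 * c)^-1 by rewrite sqr_sqrtr// ltW.
have s0 : 0 < s by rewrite sqrtr_gt0.
pose K := expR (a - c * m ^+ 2) / normal_peak s.
have peak0 : normal_peak s != 0 by rewrite gt_eqF// normal_peak_gt0// gt_eqF.
have qE x : expR (quad a b c x) = K * normal_pdf m s x.
  rewrite normal_pdfE ?gt_eqF// /K /normal_fun mulrA divfK// -expRD s2.
  by congr expR; rewrite /quad /m; field.
(* Both the exponential and the Gaussian density have integral one. *)
have K1 : K = 1.
  move: q1; under eq_integral do rewrite qE EFinM.
  rewrite ge0_integralZl//=.
  - by rewrite integral_normal_pdf mule1 => -[].
  - by apply/measurable_EFinP; exact: measurable_normal_pdf.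
  - by move=> x _; rewrite lee_fin normal_pdf_ge0.
  - by rewrite lee_fin divr_ge0 ?expR_ge0 ?normal_peak_ge0.
exists m, s; split => //.
by apply: (filterS (F := almost_everywhere mu)) pE => x ->; rewrite qE K1 mul1r.
Qed.

(* With Q = 1 / v^2 and P = f / v^2, the term f^2 / (2 v^2) is P^2 / (2 Q). *)
Lemma ln_density (p f v : R -> R) (x A P Q : R) : 0 < v x ->
  (v x ^+ 2)^-1 = Q -> f x / v x ^+ 2 = P -> log_constant_coef p f v x = A ->
  ln (p x) = A + 1 / 2 * (P ^+ 2 / Q) - 1 / 2 * ln Q + ln (pi *+ 2) / 2.
Proof.
move=> v0 <- <-; rewrite /log_constant_coef /normal_peak.
have vN : v x != 0 by rewrite gt_eqF.
have pi0 : (0 : R) < pi *+ 2 by rewrite mulrn_wgt0// pi_gt0.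
have ln_sqrt : ln (Num.sqrt (pi *+ 2 : R)) = ln (pi *+ 2) / 2.
  rewrite -[in RHS](sqr_sqrtr (ltW pi0)) lnXn ?sqrtr_gt0//.
  by set t := ln _; field.
have -> : ln (Num.sqrt (v x ^+ 2 * pi *+ 2))^-1 = - (ln (v x) + ln (pi *+ 2) / 2).
  rewrite -mulrnAr sqrtrM ?sqr_ge0// sqrtr_sqr gtr0_norm// -ln_sqrt.
  by rewrite lnV ?lnM ?posrE ?mulr_gt0 ?sqrtr_gt0.
rewrite (lnV (x := v x ^+ 2)) ?posrE ?exprn_gt0// lnXn// => <-.
by set t := ln (v x); set t' := ln _; set t'' := ln (p x); field.
Qed.

(** The scalar [cij] is the coefficient of [x ^ i y ^ j] in the common polynomial. Transposing the
    indices yields the data of the other direction, so the section serves both. *)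
Variables (p f v : R -> R) (c00 c01 c02 c10 c11 c12 c20 c21 c22 : R).
Hypothesis v_gt0 : forall x, 0 < v x.
Hypothesis p_gt0 : {ae mu, forall x, 0 < p x}.
Let Q := quad (- 2 * c02) (- 2 * c12) (- 2 * c22).
Let P := quad c01 c11 c21.
Hypothesis vE : forall x, (v x ^+ 2)^-1 = Q x.
Hypothesis fE : forall x, f x / v x ^+ 2 = P x.
Hypothesis pE : {ae mu, forall x, log_constant_coef p f v x = quad c00 c10 c20 x}.
Hypothesis Q'_gt0 : forall x, 0 < quad (- 2 * c20) (- 2 * c21) (- 2 * c22) x.

Let Q_gt0 x : 0 < Q x. Proof. by rewrite -vE invr_gt0 exprn_gt0. Qed.

Let v2E x : v x ^+ 2 = 1 / Q x. Proof. by rewrite -vE div1r invrK. Qed.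

Let f_ratio x : f x = P x / Q x.
Proof. by rewrite -fE -vE invrK divfK// expf_neq0// gt_eqF. Qed.

(** A nonzero [c22] rules out the constant case of [quad_gt0] for both scales, leaving negative
    discriminants. *)
Lemma quadratic_scale : c22 != 0 ->
  [/\ exists Qp Pp : {poly R}, [/\ size Qp = 3%N, (size Pp <= 3)%N,
        forall u, 0 < Qp.[u] &
        forall u, v u ^+ 2 = 1 / Qp.[u] /\ f u = Pp.[u] / Qp.[u]],
      strictly_log_mix_rational_log p,
      v u @[u --> -oo] --> (0 : R)^'+ /\ v u @[u --> +oo] --> (0 : R)^'+,
      exists l : R, f u @[u --> -oo] --> l /\ f u @[u --> +oo] --> l
    & ~ injective f /\ ~ injective v].
Proof.
move=> c22N.
have q2N : - 2 * c22 != 0 by rewrite mulf_neq0// oppr_eq0.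
have hornerE3 a b c u : (Poly [:: a; b; c]).[u] = quad a b c u :> R.
  by rewrite horner_Poly/= /quad; ring.
have [q0_gt0 [[q2_0 _]|[q2_gt0 disc]]] := quad_gt0 Q_gt0.
  by rewrite q2_0 eqxx in q2N.
have [q0'_gt0 [[q2_0 _]|[_ disc']]] := quad_gt0 Q'_gt0.
  by rewrite q2_0 eqxx in q2N.
have fEq : f = fun u => P u / Q u by apply/funext => u; exact: f_ratio.
have vEq : v = fun u => Num.sqrt (quad 1 0 0 u / Q u).
  apply/funext => u; rewrite /quad !mul0r !addr0 -v2E sqrtr_sqr gtr0_norm//.
have v_cvg (F : set_system R) (FF : ProperFilter F) :
    quad 1 0 0 u / Q u @[u --> F] --> 0 / (- 2 * c22) -> v u @[u --> F] --> 0^'+.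
  move=> F0.
  have vF0 : v u @[u --> F] --> 0.
    have := cvg_comp _ Num.sqrt F0 (@sqrt_continuous R _).
    by rewrite mul0r sqrtr0 vEq.
  (* Positivity of [v] upgrades convergence to [0] to convergence from the right. *)
  move=> S /vF0 SvF; rewrite /= /nbhs/=.
  by apply: (filterS (F := F)) SvF => u; apply; exact: v_gt0.
split.
- exists (Poly [:: - 2 * c02; - 2 * c12; - 2 * c22]), (Poly [:: c01; c11; c21]); split.
  + by rewrite (@PolyK _ 0)//=.
  + exact: size_Poly.
  + by move=> u; rewrite hornerE3; exact: Q_gt0.
  + by move=> u; rewrite !hornerE3 v2E f_ratio.
(* The parameters are the coefficients of [Q], those of [P], and [- 2 * c20] and [c10] from the
   constant term; [alpha0 ^+ 2 < alpha * delta] is the discriminant inequality [disc'] of the other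
   scale. *)
- exists (- 2 * c22), (- 2 * c12), (- 2 * c02), (- 2 * c20), c21, c11, c01, c10,
    (c00 + ln (pi *+ 2) / 2); split; first by split.
  split; first by nra.
  split => //.
  apply: (filterS2 (F := almost_everywhere mu)) p_gt0 pE => u pu Au; split => //.
  rewrite (ln_density (v_gt0 u) (vE u) (fE u) Au) /Q /P /quad.
  have -> : - 2 * c22 * u ^+ 2 + - 2 * c12 * u + - 2 * c02 =
    - 2 * c02 + - 2 * c12 * u + - 2 * c22 * u ^+ 2 by ring.
  have -> : c21 * u ^+ 2 + c11 * u + c01 = c01 + c11 * u + c21 * u ^+ 2 by ring.
  set t1 := (_ ^+ 2 / _); set t2 := ln _; set t3 := ln _.
  by field.
- by split; apply: v_cvg; [exact: quad_ratio_cvgNy|exact: quad_ratio_cvgy].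
- exists (c21 / (- 2 * c22)); rewrite fEq.
  by split; [exact: quad_ratio_cvgNy|exact: quad_ratio_cvgy].
- have not_inj (p0 p1 p2 : R) (F : R -> R) :
      F = (fun u => quad p0 p1 p2 u / Q u) -> ~ injective F.
    move=> -> F_inj.
    have [[s t] /= st PQ] := quad_ratio_not_injective p0 p1 p2 (- 2 * c02) (- 2 * c12) q2N.
    move/eqP : st; apply; apply: F_inj; apply/eqP.
    have QN u : Q u != 0 by rewrite gt_eqF.
    by rewrite /= eqr_div//; apply/eqP.
  split; first exact: (not_inj c01 c11 c21).
  (* As [v] is a function of [1 / Q], a collision of [1 / Q] is one of [v]. *)
  move=> v_inj; apply: (not_inj 1 0 0 (fun u => quad 1 0 0 u / Q u)) => // s t.
  by move=> st; apply: v_inj; rewrite vEq st.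
Qed.

(** Positive quadratics without leading term are constant, so [c12] and [c21] vanish; then [P] is
    affine and [ln p] quadratic. *)
Lemma constant_scale : c22 = 0 -> measurable_fun setT p ->
  (\int[mu]_x (p x)%:E = 1)%E ->
  [/\ exists c, forall u, v u = c, exists a b, forall u, f u = a * u + b
    & gaussian_density p].
Proof.
move=> c22_0 mp p1.
have [q0_gt0 [[_ c12_0]|[]]] := quad_gt0 Q_gt0; last by rewrite c22_0 mulr0 ltxx.
have [_ [[_ c21_0]|[]]] := quad_gt0 Q'_gt0; last by rewrite c22_0 mulr0 ltxx.
have {}c21_0 : c21 = 0 by lra.
have q0N : c02 != 0 by apply: contraTneq q0_gt0 => ->; rewrite mulr0 ltxx.
have QE u : Q u = - 2 * c02.
  by rewrite /Q /quad c22_0 c12_0 mulr0 !mul0r !addr0.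
have PE u : P u = c01 + c11 * u by rewrite /P /quad c21_0 mul0r addr0.
split.
- exists (Num.sqrt (1 / (- 2 * c02))) => u.
  by rewrite -(QE u) -v2E sqrtr_sqr gtr0_norm.
- exists (c11 / (- 2 * c02)), (c01 / (- 2 * c02)) => u.
  by rewrite f_ratio QE PE; field.
- apply: (@exp_quad_gaussian _
    (c00 + 1 / 2 * (c01 ^+ 2 / (- 2 * c02)) - 1 / 2 * ln (- 2 * c02) + ln (pi *+ 2) / 2)
    (c10 + c01 * c11 / (- 2 * c02)) (c20 + 1 / 2 * (c11 ^+ 2 / (- 2 * c02))) mp p1).
  apply: (filterS2 (F := almost_everywhere mu)) p_gt0 pE => u pu Au.
  rewrite -[LHS]lnK ?posrE//; congr expR.
  rewrite (ln_density (v_gt0 u) (vE u) (fE u) Au) QE PE /quad.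
  by set t1 := ln _; set t2 := ln _; field.
Qed.

End scenarios.

(** * The common polynomial and the conclusion *)

Lemma continuous_scale_inv (R : realType) (v : R -> R) :
  continuous v -> (forall x, 0 < v x) -> continuous (fun x => (v x ^+ 2)^-1).
Proof.
move=> cv v0 x; apply: cvgV; first by rewrite expf_neq0// gt_eqF.
by apply: (cvg_comp v (fun y => y ^+ 2)); [exact: cv|exact: exprn_continuous].
Qed.

(** The coefficients of [y] and [y ^+ 2] are continuous, so their formulas hold everywhere; the
    constant ones involve a density and are known only almost everywhere. *)
Lemma log_density_quadratic (d : measure_display) (T : measurableType d)
    (R : realType) (Pr : probability T R) (X Y : {RV Pr >-> R})
    (p_x p_y f v g w : R -> R) :
  has_density X p_x -> has_density Y p_y ->
  location_scale_model X Y f v -> location_scale_model Y X g w ->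
  exists c00 c01 c02 c10 c11 c12 c20 c21 c22 : R,
  [/\ forall x, (v x ^+ 2)^-1 = quad (- 2 * c02) (- 2 * c12) (- 2 * c22) x,
      forall x, f x / v x ^+ 2 = quad c01 c11 c21 x
    & {ae lebesgue_measure, forall x,
        log_constant_coef p_x f v x = quad c00 c10 c20 x}] /\
  [/\ forall y, (w y ^+ 2)^-1 = quad (- 2 * c20) (- 2 * c21) (- 2 * c22) y,
      forall y, g y / w y ^+ 2 = quad c10 c11 c12 y
    & {ae lebesgue_measure, forall y,
        log_constant_coef p_y g w y = quad c00 c01 c02 y}].
Proof.
move=> hX hY fw bw.
have [/twice_differentiable_continuous cf /twice_differentiable_continuous cv v0 _] := fw.
have [/twice_differentiable_continuous cg /twice_differentiable_continuous cw w0 _] := bw.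
have [xy _] := log_density_ae_eq hX hY fw bw.
have [yx _] := log_density_ae_eq hY hX bw fw.
pose A := log_constant_coef p_x f v; pose A' := log_constant_coef p_y g w.
pose P x := f x / v x ^+ 2; pose P' y := g y / w y ^+ 2.
pose Q x := (- ((v x ^+ 2)^-1 / 2)); pose Q' y := (- ((w y ^+ 2)^-1 / 2)).
have cQ : continuous Q.
  by move=> x; apply: cvgN; apply: cvgMr_tmp; exact: continuous_scale_inv.
have cQ' : continuous Q'.
  by move=> x; apply: cvgN; apply: cvgMr_tmp; exact: continuous_scale_inv.
have cP : continuous P.
  by move=> x; apply: cvgM; [exact: cf|exact: continuous_scale_inv].
have cP' : continuous P'.
  by move=> x; apply: cvgM; [exact: cg|exact: continuous_scale_inv].
have {}xy : {ae lebesgue_measure, forall x, {ae lebesgue_measure, forall y,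
    quad (A x) (P x) (Q x) y = quad (A' y) (P' y) (Q' y) x}}.
  apply: (filterS (F := almost_everywhere lebesgue_measure)) xy => x.
  apply: (filterS (F := almost_everywhere lebesgue_measure)) => y.
  by rewrite /quad /Q /Q' !mulNr.
have {}yx : {ae lebesgue_measure, forall y, {ae lebesgue_measure, forall x,
    quad (A x) (P x) (Q x) y = quad (A' y) (P' y) (Q' y) x}}.
  apply: (filterS (F := almost_everywhere lebesgue_measure)) yx => y.
  apply: (filterS (F := almost_everywhere lebesgue_measure)) => x.
  by rewrite /quad /Q /Q' !mulNr.
have xy_sym : {ae lebesgue_measure, forall x, {ae lebesgue_measure, forall y,
    quad (A' y) (P' y) (Q' y) x = quad (A x) (P x) (Q x) y}}.
  apply: (filterS (F := almost_everywhere lebesgue_measure)) xy => x.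
  by apply: (filterS (F := almost_everywhere lebesgue_measure)) => y.
have [a0 [a1 [a2 [p0 [p1 [p2 [q0 [q1 [q2 APQ]]]]]]]]] := ae_quad_coef yx.
have [a0' [a1' [a2' [p0' [p1' [p2' [q0' [q1' [q2' APQ']]]]]]]]] := ae_quad_coef xy_sym.
have AE : {ae lebesgue_measure, forall x, A x = quad a0 a1 a2 x}.
  by apply: (filterS (F := almost_everywhere lebesgue_measure)) APQ => x [].
have PE : forall x, P x = quad p0 p1 p2 x.
  apply: ae_eq_continuous => //; first exact: continuous_quad.
  by apply: (filterS (F := almost_everywhere lebesgue_measure)) APQ => x [].
have QE : forall x, Q x = quad q0 q1 q2 x.
  apply: ae_eq_continuous => //; first exact: continuous_quad.
  by apply: (filterS (F := almost_everywhere lebesgue_measure)) APQ => x [].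
have AE' : {ae lebesgue_measure, forall x, A' x = quad a0' a1' a2' x}.
  by apply: (filterS (F := almost_everywhere lebesgue_measure)) APQ' => x [].
have PE' : forall x, P' x = quad p0' p1' p2' x.
  apply: ae_eq_continuous => //; first exact: continuous_quad.
  by apply: (filterS (F := almost_everywhere lebesgue_measure)) APQ' => x [].
have QE' : forall x, Q' x = quad q0' q1' q2' x.
  apply: ae_eq_continuous => //; first exact: continuous_quad.
  by apply: (filterS (F := almost_everywhere lebesgue_measure)) APQ' => x [].
have [[e1 e2 e3] [[e4 e5 e6] [e7 e8 e9]]] := quad_eq AE PE QE AE' PE' QE' xy.
(* The letters [a], [p], [q] stand for the powers 0, 1, 2 of [y], and the index for the power of
   [x]. *)
exists a0, p0, q0, a1, p1, q1, a2, p2, q2.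
have scaleE (V c0 c1 c2 u : R) : - (V / 2) = quad c0 c1 c2 u ->
    V = quad (- 2 * c0) (- 2 * c1) (- 2 * c2) u.
  by rewrite /quad => h; lra.
split; split => //.
- by move=> x; apply: scaleE; exact: QE.
- by move=> y; apply: scaleE; rewrite -e7 -e8 -e9; exact: QE'.
- by move=> y; rewrite -e4 -e5 -e6; exact: PE'.
- by rewrite -e1 -e2 -e3.
Qed.

Theorem theorem2 (R : realType) (d : measure_display) (T : measurableType d)
    (Pr : probability T R) (X Y : {RV Pr >-> R}) (p_x p_y : R -> R)
    (f v g w : R -> R)
    (hpx : has_density X p_x) (hpy : has_density Y p_y)
    (forward : location_scale_model X Y f v)
    (backward : location_scale_model Y X g w) :
  ((exists Q P Q' P' : {poly R},
      [/\ size Q = 3%N, size Q' = 3%N, (size P <= 3)%N & (size P' <= 3)%N] /\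
      (forall u, 0 < Q.[u]) /\ (forall u, 0 < Q'.[u]) /\
      (forall u, v u ^+ 2 = 1 / Q.[u] /\ f u = P.[u] / Q.[u]) /\
      (forall u, w u ^+ 2 = 1 / Q'.[u] /\ g u = P'.[u] / Q'.[u])) /\
   strictly_log_mix_rational_log p_x /\
   strictly_log_mix_rational_log p_y /\
   (v u @[u --> -oo] --> (0 : R)^'+ /\ v u @[u --> +oo] --> (0 : R)^'+) /\
   (exists l : R, f u @[u --> -oo] --> l /\ f u @[u --> +oo] --> l) /\
   (w u @[u --> -oo] --> (0 : R)^'+ /\ w u @[u --> +oo] --> (0 : R)^'+) /\
   (exists l : R, g u @[u --> -oo] --> l /\ g u @[u --> +oo] --> l) /\
   [/\ ~ injective f, ~ injective v, ~ injective g & ~ injective w])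
  \/
  ((exists c : R, forall u, v u = c) /\
   (exists c : R, forall u, w u = c) /\
   (exists a b : R, forall u, f u = a * u + b) /\
   (exists a b : R, forall u, g u = a * u + b) /\
   gaussian_density p_x /\ gaussian_density p_y).
Proof.
have [c00 [c01 [c02 [c10 [c11 [c12 [c20 [c21 [c22 [[vE fE pxE] [wE gE pyE]]]]]]]]]]] :=
  log_density_quadratic hpx hpy forward backward.
have [_ px0] := log_density_ae_eq hpx hpy forward backward.
have [_ py0] := log_density_ae_eq hpy hpx backward forward.
have [_ _ v0 _] := forward; have [_ _ w0 _] := backward.
have Q0 x : 0 < quad (- 2 * c02) (- 2 * c12) (- 2 * c22) x.
  by rewrite -vE invr_gt0 exprn_gt0.
have Q0' y : 0 < quad (- 2 * c20) (- 2 * c21) (- 2 * c22) y.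
  by rewrite -wE invr_gt0 exprn_gt0.
(* The coefficient [c22] is shared by both scales, so one case split decides both directions. *)
have [c22_0|c22N] := eqVneq c22 0.
  have [mpx _ _] := hpx; have [mpy _ _] := hpy.
  have [v_cst f_lin px_gauss] :=
    constant_scale v0 px0 vE fE pxE Q0' c22_0 mpx (density_integral1 hpx).
  have [w_cst g_lin py_gauss] :=
    constant_scale w0 py0 wE gE pyE Q0 c22_0 mpy (density_integral1 hpy).
  by right.
left.
have [[Q [P [sQ sP QP0 QPE]]] px_log v_lim f_lim [f_inj v_inj]] :=
  quadratic_scale v0 px0 vE fE pxE Q0' c22N.
have [[Q' [P' [sQ' sP' QP0' QPE']]] py_log w_lim g_lim [g_inj w_inj]] :=
  quadratic_scale w0 py0 wE gE pyE Q0 c22N.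
by do !split => //; exists Q, P, Q', P'.
Qed.
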